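(* Let $X$ be a Hausdorff space and let $(Y,\mathcal{U})$ be a uniform space which, with the topology induced by $\mathcal{U}$, is a quadra space. Let $\lambda$ be a saturation family of subsets of $X$. Then the topology on $C(X,Y)$ induced by the uniformity $\hat{\mathcal{U}}|\lambda$ of uniform convergence on $\lambda$ coincides with the $\lambda$-open topology on $C(X,Y)$, where $Y$ has the topology induced by $\mathcal{U}$.
   Context: $C(X,Y)$ is the set of all continuous maps from $X$ to $Y$, where $Y$ carries the topology induced by $\mathcal{U}$. A space $Y$ is called a quadra space if for every point $x\in Y\times Y$ there are a continuous map $f:Y\times Y\to Y$ and a point $y\in Y$ such that $f^{-1}(y)=\{x\}$. A subset $A\subseteq X$ is $Y$-compact if $f(A)$ is compact for every $f\in C(X,Y)$. A zero-set of $Y$ is a set of the form $h^{-1}(0)$ with $h:Y\to\mathbb{R}$ continuous. A subset $B\subseteq X$ is a $Y$-zero-set if $B=f^{-1}(Z)$ for some zero-set $Z$ of $Y$ and some $f\in C(X,Y)$. A family $\lambda$ of non-empty subsets of $X$ is a $\pi$-network for $X$ if every non-empty open set $U\subseteq X$ contains some $A\in\lambda$. The family $\lambda$ is hereditary with respect to $Y$-zero-set subsets of $X$ if $A\cap B\in\lambda$ whenever $A\in\lambda$, $B$ is a $Y$-zero-set of $X$ and $A\cap B\neq\emptyset$. A saturation family is a family $\lambda$ of $Y$-compact subsets of $X$ that is a $\pi$-network for $X$ and is hereditary with respect to $Y$-zero-set subsets of $X$. The uniformity $\hat{\mathcal{U}}|\lambda$ on $C(X,Y)$ is the one generated by the base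 consisting of all finite intersections of sets of the form $\hat{V}|A=\{(f,g): (f(x),g(x))\in V \text{ for every } x\in A\}$ with $V\in\mathcal{U}$ and $A\in\lambda$. The $\lambda$-open (set-open) topology on $C(X,Y)$ has as a subbase all sets $[A,U]=\{f\in C(X,Y): f(A)\subseteq U\}$, with $A\in\lambda$ and $U$ open in $Y$. *)

(* Defs.v *)
From HB Require Import structures.
From mathcomp Require Import all_boot all_order all_algebra.
From mathcomp Require Import finmap.
From mathcomp Require Import all_classical all_reals all_analysis.
Import numFieldNormedType.Exports.

Set Implicit Arguments.
Unset Strict Implicit.
Unset Printing Implicit Defensive.

Local Open Scope classical_set_scope.
Local Open Scope ring_scope.

Definition quadra_space (Y : topologicalType) : Prop :=
  forall x : Y * Y, exists (f : Y * Y -> Y) (y : Y),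
    continuous f /\ f @^-1` [set y] = [set x].

Definition Y_compact (X Y : topologicalType) (A : set X) : Prop :=
  forall f : X -> Y, continuous f -> compact (f @` A).

Definition zero_set (R : realType) (Y : topologicalType) (Z : set Y) : Prop :=
  exists2 h : Y -> R, continuous h & Z = h @^-1` [set 0].

Definition Y_zero_set (R : realType) (X Y : topologicalType) (B : set X) :
    Prop :=
  exists (f : X -> Y) (Z : set Y),
    [/\ continuous f, zero_set R Z & B = f @^-1` Z].

Definition pi_network (X : topologicalType) (lam : set (set X)) : Prop :=
  (forall A, lam A -> A !=set0) /\
  (forall U : set X, open U -> U !=set0 -> exists2 A, lam A & A `<=` U).

Definition hereditary_zero (R : realType) (X Y : topologicalType)
    (lam : set (set X)) : Prop :=
  forall A B : set X, lam A -> Y_zero_set R Y B -> A `&` B !=set0 ->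
    lam (A `&` B).

Record saturation_family (R : realType) (X Y : topologicalType)
    (lam : set (set X)) : Prop := SaturationFamily {
  saturation_compact : forall A, lam A -> Y_compact Y A;
  saturation_pi_network : pi_network lam;
  saturation_hereditary : hereditary_zero R Y lam
}.

Section UniformConvergenceOn.
Local Open Scope relation_scope.
Variables (X : topologicalType) (Y : uniformType) (lam : set (set X)).

(* An alias of C(X, Y); [lam] is kept as a phantom argument because it
   determines the uniform structure attached to the alias. *)
Definition uniform_on : Type := let _ := lam in continuousType X Y.

HB.instance Definition _ := Choice.on uniform_on.

Definition uniform_on_rel (V : set (Y * Y)) (A : set X) :
    set (uniform_on * uniform_on) :=
  [set fg : uniform_on * uniform_on |
    forall x, A x -> V (fg.1 x, fg.2 x)].

(* [finI_from] includes the empty intersection, so this is also a filter when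
   [lam] is empty. *)
Definition uniform_on_ent : set_system (uniform_on * uniform_on) :=
  filter_from
    (finI_from [set VA : set (Y * Y) * set X | entourage VA.1 /\ lam VA.2]
               (fun VA => uniform_on_rel VA.1 VA.2)) id.

Let ent_filter : Filter uniform_on_ent.
Proof.
apply: filter_from_filter.
  by exists setT, fset0 => //; rewrite set_fset0 bigcap_set0.
by move=> P Q FP FQ; exists (P `&` Q) => //; exact: finI_fromI.
Qed.

Let ent_refl E : uniform_on_ent E -> diagonal `<=` E.
Proof.
move=> [_ [F FD <-] sE] [f g] /diagonalP ->; apply: sE => VA FVA x _.
by have /FD/set_mem[eV _] := FVA; exact: entourage_refl.
Qed.

Let ent_inv E : uniform_on_ent E -> uniform_on_ent E^-1.
Proof.
move=> [_ [F FD <-] sE].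
exists (\bigcap_(VA in [set` F]) (uniform_on_rel VA.1 VA.2)^-1); last first.
  by move=> fg H; exact: sE.
exists [fset ((VA.1)^-1, VA.2) | VA in F]%fset.
  move=> _ /imfsetP[VA /= /FD/set_mem[eV lA] ->]; apply/mem_set.
  by split=> //=; exact: entourage_inv.
by rewrite set_imfset bigcap_image.
Qed.

Let ent_split E : uniform_on_ent E ->
  exists2 E', uniform_on_ent E' & E' \; E' `<=` E.
Proof.
move=> [_ [F FD <-] sE].
pose E' := \bigcap_(VA in [set` F]) uniform_on_rel (split_ent VA.1) VA.2.
exists E'.
  exists E' => //; exists [fset (split_ent VA.1, VA.2) | VA in F]%fset.
    move=> _ /imfsetP[VA /= /FD/set_mem[eV lA] ->]; apply/mem_set.
    by split=> //=; exact: entourage_split_ent.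
  by rewrite set_imfset bigcap_image.
move=> [f g] [h /= fh hg]; apply: sE => VA FVA x Ax.
have /FD/set_mem[eV _] := FVA.
exact: (entourage_split (h x) eV (fh _ FVA _ Ax) (hg _ FVA _ Ax)).
Qed.

HB.instance Definition _ := isUniform.Build uniform_on
  ent_filter ent_refl ent_inv ent_split.

End UniformConvergenceOn.

Section SetOpen.
Variables (X Y : topologicalType) (lam : set (set X)).

Definition set_open : Type := let _ := lam in continuousType X Y.

HB.instance Definition _ := Choice.on set_open.

HB.instance Definition _ := isSubBaseTopological.Build set_open
  [set AU : set X * set Y | lam AU.1 /\ open AU.2]
  (fun AU => [set f : set_open | f @` AU.1 `<=` AU.2]).

End SetOpen.

(* Main.v *)
Require Import Defs.
From mathcomp Require Import all_boot all_order all_algebra.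
From mathcomp Require Import all_classical all_reals all_analysis.
From mathcomp Require Import finmap lra.
Import numFieldNormedType.Exports Order.TTheory Num.Theory.

(** Both topologies are given by finite intersections of elementary sets, so it
    is enough that every elementary neighbourhood of a map [f] for one topology
    is a neighbourhood of [f] for the other. Each of these two claims says that
    a condition on the pair [(f x, g x)] holds for all [x] in some [A] of [lam]
    as soon as [g] is close to [f]. Since [f @` A] is compact, the condition can
    be checked locally on [f @` A]: this is [compact_image_near].

    If [f] maps [A] into an open set [U], then around [f x] the triangle
    inequality for a half-size entourage keeps [g z] in [U] whenever [f z] is
    near [f x] and [g] is uniformly close to [f] on [A]
    ([near_uniform_on_image_sub]).

    Conversely, let [V] be an entourage. A uniform space is completely regular,
    so [f x] has a zero-set neighbourhood [Z] inside a [V]-small open set [U]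
    ([zero_set_nbhs]). Heredity puts [A `&` f @^-1` Z] in [lam], hence the maps
    [g] that send this set into [U] form a set-open neighbourhood of [f]; for
    such [g], both [f z] and [g z] lie in the [V]-small set [U] when [f z] is in
    [Z] ([near_set_open_rel]). *)

Local Open Scope classical_set_scope.
Local Open Scope ring_scope.

(** Compactness in its near-covering form replaces the choice of a finite
    subcover and the intersection of the finitely many conditions on [g]. *)
Lemma compact_image_near {T : Type} {X Y : topologicalType} {F : set_system T}
    {f : X -> Y} {A : set X} (Q : T -> X -> Prop) : Filter F ->
  compact (f @` A) ->
  (forall x, A x -> exists2 N : set Y, nbhs (f x) N &
     F [set g | forall z, A z -> N (f z) -> Q g z]) ->
  F [set g | forall z, A z -> Q g z].
Proof.
move=> FF /compact_near_coveringP cA locQ.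
(* Near covering speaks of points of [f @` A], so [Q] is first turned into a
   condition on [y] that quantifies over the fibre of [f] above [y]. *)
have near_fA := cA T F (fun g y => forall z, A z -> f z = y -> Q g z) FF.
apply: filterS (near_fA _).
  by move=> g Qg z Az; apply: (Qg (f z)) => //; exists z.
move=> _ [x Ax <-]; have [N nN FN] := locQ _ Ax.
exists (N, [set g | forall z, A z -> N (f z) -> Q g z]); first by split.
by move=> [y g] /= [Ny Qg] z Az fzy; apply: Qg => //; rewrite fzy.
Qed.

(** Complete regularity: if a Urysohn function [h] is [0] at [y] and [1] off
    [U], then its sublevel set at [1/2] is the zero-set of [max (h - 1/2) 0]. *)
Lemma zero_set_nbhs (R : realType) {Y : uniformType} {y : Y} {U : set Y} :
  nbhs y U -> exists Z : set Y, [/\ zero_set R Z, nbhs y Z & Z `<=` U].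
Proof.
rewrite {1}nbhsE => -[V [oV Vy] VU].
have nVy : ~ (~` V) y by apply.
have := @uniform_completely_regular R Y y (~` V) (open_closedC oV) nVy.
move=> /(@uniform_separatorP _ R)[h [ch _ h0 h1]].
have hy : h y = 0 by apply: h0; exists y.
exists [set z | h z <= 2^-1]; split.
- exists ((fun z => h z - 2^-1) \max cst 0).
    move=> z; refine (@continuous_max R Y _ _ z _ _); last exact: cvg_cst.
    by apply: (@cvgB R R^o); [exact: ch|exact: cvg_cst].
  by apply/seteqP; split=> z /=; case: (lerP (h z - 2^-1) 0) => hz; lra.
- have h_lt : nbhs (h y) [set r : R | r < 2^-1].
    by apply: lt_nbhsl; rewrite hy invr_gt0.
  have h_near : nbhs y (h @^-1` [set r : R | r < 2^-1]) := ch y _ h_lt.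
  by apply: filterS h_near => z /ltW.
- move=> z /= hz; apply: VU; apply: contrapT => nVz.
  have : h z = 1 by apply: h1; exists z.
  lra.
Qed.

Lemma nbhs_uniform_on_rel {X : topologicalType} {Y : uniformType}
    {lam : set (set X)} (f : uniform_on Y lam) {A : set X} {V : set (Y * Y)} :
  entourage V -> lam A ->
  nbhs f [set g : uniform_on Y lam | forall x, A x -> V (f x, g x)].
Proof.
move=> eV lA; apply/nbhsP; exists (uniform_on_rel (lam := lam) V A).
  exists (uniform_on_rel (lam := lam) V A) => //.
  exists [fset (V, A)]%fset; first by move=> VA /fset1P ->; apply/mem_set.
  by rewrite set_fset1 bigcap_set1.
by move=> g /xsectionP.
Qed.

Lemma nbhs_set_open {X Y : topologicalType} {lam : set (set X)}
    (f : set_open Y lam) {A : set X} {U : set Y} :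
  lam A -> open U -> f @` A `<=` U ->
  nbhs f [set g : set_open Y lam | g @` A `<=` U].
Proof.
move=> lA oU fAU; apply: open_nbhs_nbhs; split=> //.
exists [set [set g : set_open Y lam | g @` A `<=` U]].
  move=> _ ->; exists [fset (A, U)]%fset.
    by move=> AU /fset1P ->; apply/mem_set.
  by rewrite set_fset1 bigcap_set1.
by rewrite bigcup_set1.
Qed.

(** Locally on the compact set [f @` A], one entourage [V] with
    [xsection V (f x) `<=` U] suffices: half of it absorbs the move from [f x]
    to [f z], the other half the move from [f z] to [g z]. *)
Lemma near_uniform_on_image_sub {X : topologicalType} {Y : uniformType}
    {lam : set (set X)} (f : uniform_on Y lam) {A : set X} {U : set Y} :
  lam A -> compact (f @` A) -> open U -> f @` A `<=` U ->
  nbhs f [set g : uniform_on Y lam | g @` A `<=` U].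
Proof.
move=> lA cA oU fAU.
suff : nbhs f [set g : uniform_on Y lam | forall z, A z -> U (g z)].
  by apply: filterS => g gU _ [z Az <-]; exact: gU.
apply: (compact_image_near (fun (g : uniform_on Y lam) z => U (g z)) _ cA).
move=> x Ax.
have /nbhsP[V eV VU] : nbhs (f x) U.
  by apply: open_nbhs_nbhs; split=> //; apply: fAU; exists x.
have eW := entourage_split_ent eV.
exists (xsection (split_ent V) (f x)); first exact: nbhs_entourage.
apply: filterS (nbhs_uniform_on_rel f eW lA) => g fg z Az /xsectionP fxz.
by apply/VU/mem_set; exact: (entourage_split _ eV fxz (fg _ Az)).
Qed.

(** Locally on [f @` A], closeness to [f] is a single subbasic condition
    [g @` (A `&` f @^-1` Z) `<=` U] with [U] a [V]-small neighbourhood of [f x];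
    [Z] has to be a zero-set for heredity to apply and a neighbourhood of [f x]
    for compactness to apply. *)
Lemma near_set_open_rel (R : realType) {X : topologicalType} {Y : uniformType}
    {lam : set (set X)} (f : set_open Y lam) {A : set X} {V : set (Y * Y)} :
  hereditary_zero R Y lam -> lam A -> compact (f @` A) -> entourage V ->
  nbhs f [set g : set_open Y lam | forall x, A x -> V (f x, g x)].
Proof.
move=> hlam lA cA eV; pose W := split_ent V.
apply: (compact_image_near
  (fun (g : set_open Y lam) z => V (f z, g z)) _ cA) => x Ax.
pose U := interior (xsection (W `&` W^-1)%relation (f x)).
have eW : entourage (W `&` W^-1)%relation.
  by apply: filterI; [|apply: entourage_inv]; exact: entourage_split_ent.
have [Z [Z0 nZ ZU]] : exists Z, [/\ zero_set R Z, nbhs (f x) Z & Z `<=` U].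
  by apply: zero_set_nbhs; apply: nbhs_interior; exact: nbhs_entourage.
exists Z => //.
have lAZ : lam (A `&` f @^-1` Z).
  apply: hlam => //; first by exists f, Z; split => //; exact: cts_fun.
  by exists x; split=> //; exact: nbhs_singleton nZ.
have fAZ : f @` (A `&` f @^-1` Z) `<=` U by move=> _ [z [_ Zz] <-]; exact: ZU.
apply: filterS (nbhs_set_open f lAZ (@open_interior _ _) fAZ) => g gAZ z Az Zz.
have /interior_subset/xsectionP[_ Wz] := ZU _ Zz.
have /interior_subset/xsectionP[Wg _] : U (g z) by apply: gAZ; exists z.
exact: (entourage_split _ eV Wz Wg).
Qed.

Theorem theorem3p3 (R : realType) (X : topologicalType) (Y : uniformType)
    (lam : set (set X)) (hX : hausdorff_space X) (hY : quadra_space Y)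
    (hlam : saturation_family R Y lam) :
  forall O : set (continuousType X Y),
    @open (uniform_on Y lam) O <-> @open (set_open Y lam) O.
Proof.
move=> O; have [clam _ zlam] := hlam.
have cA (f : continuousType X Y) A : lam A -> compact (f @` A).
  by move=> lA; exact: clam lA _ (@cts_fun _ _ f).
split=> oO.
- rewrite (@openE (set_open Y lam)) => f Of.
  have nbhs_f_filter := @nbhs_filter (set_open Y lam) f.
  have : @nbhs _ (uniform_on Y lam) f O by apply: open_nbhs_nbhs.
  move=> /(@nbhsP (uniform_on Y lam))[E [_ [D DD <-] DE] EO].
  have : @nbhs _ (set_open Y lam) f (\bigcap_(VA in [set` D])
      [set g | uniform_on_rel (lam := lam) VA.1 VA.2 (f, g)]).
    apply: filter_bigI => -[V A] /DD/set_mem[/= eV lA].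
    exact: (near_set_open_rel R f zlam lA (cA f A lA) eV).
  apply: filterS => g fg; apply: EO; apply/xsectionP; apply: DE => VA DVA.
  exact: fg.
- rewrite (@openE (uniform_on Y lam)) => f Of.
  have nbhs_f_filter := @nbhs_filter (uniform_on Y lam) f.
  case: oO Of => B BD <- [C BC Cf].
  have [D DD DC] := BD _ BC; rewrite -DC in Cf.
  have : @nbhs _ (uniform_on Y lam) f (\bigcap_(AU in [set` D])
      [set g : uniform_on Y lam | g @` AU.1 `<=` AU.2]).
    apply: filter_bigI => -[A U] DAU; have /DD/set_mem[/= lA oU] := DAU.
    exact: (near_uniform_on_image_sub f lA (cA f A lA) oU (Cf _ DAU)).
  by apply: filterS => g fg; exists C => //; rewrite -DC.
Qed.
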